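(* Assume $2^{<\mathfrak{c}} = \mathfrak{c}$. Let $X$ be a Hausdorff space such that $\hat{s}(X) \cdot g(X) \leq \mathfrak{c}$. Then $|X| \leq \mathfrak{c}$.
   Context: All spaces are Hausdorff. $\mathfrak{c} = 2^{\aleph_0}$ and $2^{<\mathfrak{c}} = \sup\{2^\lambda : \lambda < \mathfrak{c}\}$. A subset of $X$ is discrete if its subspace topology is discrete (it need not be closed). $\hat{s}(X) = \min\{\kappa : \text{if } A \subset X \text{ and } |A| = \kappa \text{ then } A \text{ is not a discrete set}\}$, so $\hat{s}(X) \leq \mathfrak{c}$ means that every discrete set in $X$ has size $<\mathfrak{c}$. $g(X) = \sup\{|\overline{D}| : D \subset X \text{ is discrete}\}$. *)

(* Defs.v *)
From mathcomp Require Import all_boot all_classical topology separation_axioms.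

Set Implicit Arguments.
Unset Strict Implicit.
Unset Printing Implicit Defensive.

Local Open Scope classical_set_scope.
Local Open Scope card_scope.

(* As in mathcomp.classical.cardinality, a cardinal is represented by a set,
   and cardinals are compared only through #<= and #=. *)

Definition card_lt T U (A : set T) (B : set U) : Prop :=
  A #<= B /\ ~ (B #<= A).
Notation "A '#<' B" := (card_lt A B)
  (at level 79, format "A  '#<'  B") : card_scope.

Definition card_exp2 T (A : set T) : set (set T) := [set B | B `<=` A].

(* The minimum of a class P of cardinals, read on the representatives in
   [set T]. This is the true minimum as soon as P contains a cardinal that is
   at most the cardinal of T, since every smaller one is represented too. *)
Definition card_min T (P : set (set T)) : set T :=
  xget set0 [set K | P K /\ forall K', P K' -> K #<= K'].

(* The cardinals are well ordered, so the default set0 is used only for an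
   empty class. *)
Lemma card_minP T (P : set (set T)) : P !=set0 ->
  P (card_min P) /\ forall K, P K -> card_min P #<= K.
Proof.
move=> [K0 PK0].
apply: (@xgetPex _ set0 [set K | P K /\ forall K', P K' -> K #<= K']) => /=.
pose good (S : set (set T -> T)) :=
  (forall f, S f -> forall K, P K -> K (f K)) /\
  (forall f g, S f -> S g -> forall K, P K -> f K = g K -> f = g).
have [F Fgood Ftot|S [[SK Sinj] Smax]] := @Zorn_bigcup _ good.
  split=> [f [X FX Xf]|f g [X FX Xf] [Y FY Yg]].
    by have [XK _] := Fgood _ FX; apply: XK.
  have [XY|YX] := Ftot _ _ FX FY.
    by have [_] := Fgood _ FY; apply=> //; apply: XY.
  by have [_] := Fgood _ FX; apply=> //; apply: YX.
have [[K [PK Ksurj]]|nsurj] :=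
  pselect (exists K, P K /\ forall x, K x -> exists2 f, S f & f K = x).
  exists K; split=> // K' PK'.
  have /choice[h hP] : forall x, exists f, K x -> S f /\ f K = x.
    move=> x; have [Kx|nKx] := pselect (K x); last by exists (fun=> x).
    by have [f Sf fKx] := Ksurj x Kx; exists f.
  have /injfunPex[f] : exists2 f : T -> T, set_fun K K' f & set_inj K f.
    exists (fun x => h x K') => [x Kx|x y /set_mem Kx /set_mem Ky /= hxy].
      by have [Sh _] := hP _ Kx; exact: (SK _ Sh).
    have [Shx <-] := hP _ Kx; have [Shy <-] := hP _ Ky.
    by rewrite (Sinj _ _ Shx Shy _ PK' hxy).
  exact: inj_card_le f.
have missed K : P K -> exists x, K x /\ forall f, S f -> f K <> x.
  move=> PK; apply: contrapT => nx; apply: nsurj; exists K; split=> // x Kx.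
  apply: contrapT => nf; apply: nx; exists x; split=> // f Sf fKx.
  by apply: nf; exists f.
have [x0 _] := missed _ PK0.
have /choice[g gP] :
    forall K, exists x, P K -> K x /\ forall f, S f -> f K <> x.
  move=> K; have [/missed[x xP]|nPK] := pselect (P K); first by exists x.
  by exists x0.
exfalso; apply: (Smax (S `|` [set g])).
  split=> [f Sf|sub]; first by left.
  have [_ gK] := gP _ PK0.
  exact: gK (sub g (or_intror erefl)) erefl.
split=> [f [Sf|->] K PK|f f' [Sf|->] [Sf'|->] K PK //].
- exact: (SK _ Sf).
- by have [] := gP _ PK.
- exact: (Sinj _ _ Sf Sf' K PK).
- by have [_ gK] := gP _ PK => /(gK _ Sf).
- by have [_ gK] := gP _ PK => /esym /(gK _ Sf').
Qed.

Definition continuum : set (set nat) := card_exp2 [set: nat].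

(* The supremum of a family of cardinals: its least upper bound, where all of
   T is always an upper bound. *)
Definition card_sup T (F : set (set T)) : set T :=
  card_min [set K | forall A, F A -> A #<= K].

Lemma card_supP T (F : set (set T)) :
  (forall A, F A -> A #<= card_sup F) /\
  forall K : set T, (forall A, F A -> A #<= K) -> card_sup F #<= K.
Proof.
apply: (@card_minP T [set K | forall A, F A -> A #<= K]).
by exists setT => A _; apply: subset_card_le.
Qed.

Definition exp2_lt_continuum : set (set (set nat)) :=
  card_sup [set card_exp2 L | L in [set L : set (set nat) | L #< continuum]].

Definition discrete_set (X : topologicalType) (A : set X) : Prop :=
  forall B : set A, open B.

Lemma discrete_setP (X : topologicalType) (A : set X) :
  discrete_set A <-> isolated A = A.
Proof.
split=> [dA|iA B].
  apply/seteqP; split=> [|x Ax]; first exact: isolatedS.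
  split; first exact/mem_set.
  have [W oW WE] := dA [set SigSub (mem_set Ax)].
  have Wx : W x by have : (set_val @^-1` W) (SigSub (mem_set Ax)) by rewrite WE.
  exists W; first exact: open_nbhs_nbhs.
  apply/seteqP; split=> [y [Wy Ay]|_ ->//].
  have : (set_val @^-1` W) (SigSub (mem_set Ay)) by [].
  by rewrite WE => /(congr1 val).
rewrite openE => x Bx; rewrite /interior.
have : A (val x) by exact: set_valP.
rewrite -{1}iA => -[_ [V Vx VA]].
have : nbhs x (set_val @^-1` V) by exact: (initial_continuous (f := set_val)) Vx.
apply: filterS => y Vy; suff -> : y = x by exact: Bx.
have : (V `&` A) (val y) by split=> //; exact: set_valP.
by rewrite VA => /val_inj.
Qed.

(* The invariant may exceed the cardinal of X (it does when X is discrete), so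
   it is represented in [set (set X)]. *)
Definition shat (X : topologicalType) : set (set X) :=
  card_min [set K | forall A : set X, A #= K -> ~ discrete_set A].
Arguments shat : clear implicits.

Lemma shatP (X : topologicalType) :
  (forall A : set X, A #= shat X -> ~ discrete_set A) /\
  forall K : set (set X),
    (forall A : set X, A #= K -> ~ discrete_set A) -> shat X #<= K.
Proof.
apply: (@card_minP _ [set K | forall A : set X, A #= K -> ~ discrete_set A]).
exists setT => A; rewrite card_eq_le => /andP[_ /card_leP[f]] _.
pose h (B : set X) : X := val (f (SigSub (mem_set (I : setT B)))).
have hI B C : h B = h C -> B = C.
  by move=> /val_inj/inj; rewrite !inE => /(_ I I)/(congr1 val).
pose D := [set x | exists B, x = h B /\ ~ B x].
have nD : ~ D (h D) by move=> /[dup] DD [B [/hI <-]]; exact.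
by apply: (nD); exists D.
Qed.

Definition gsup (X : topologicalType) : set X :=
  card_sup [set closure D | D in [set D : set X | discrete_set D]].
Arguments gsup : clear implicits.

(* Main.v *)
From Stdlib Require Inverse_Image.
Require Import Defs.
From mathcomp Require Import all_boot all_classical topology separation_axioms.
Local Open Scope classical_set_scope.
Local Open Scope card_scope.

(** Write c for the continuum and call a set small when its cardinality is
    less than c, that is, when it does not have c elements.

    The proof is a closing-off argument. By Sapirovskii's lemma
    ([sapirovskii]), whenever an open neighbourhood U y is attached to each
    point y of a set Y, there is a discrete D contained in Y such that Y is
    covered by the closure of D together with the sets U y for y in D. The
    hypothesis on the first invariant says that discrete sets are small
    ([small_discrete_set]), the one on the second that their closures have at
    most c points.

    Sapirovskii's lemma is used twice. Applied to the complement of a point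
    x, with neighbourhoods whose closures avoid x, it yields at most c open
    neighbourhoods U x i of x (i ranging over sets of natural numbers) with
    intersection {x} ([pseudocharacter_le_continuum]). Next, close off: there
    is a set A' of at most c points such that for every small partial choice B
    of indices at points of A', with domain D discrete,
    - the closure of D is contained in A', and
    - if that closure and the sets U x i, for (x, i) in B, do not cover X,
      then some point of A' is left uncovered.
    Such an A' is all of X. If p were outside A', choose for each x in A' an
    index i x such that U x (i x) avoids p, and apply Sapirovskii's lemma to
    A' and these neighbourhoods. The resulting sets cover A', so by the
    second closure property they cover X, p included; but p avoids each
    U x (i x), and the closure of D lies in A'.

    That an A' of size at most c exists ([closing_off]) is where
    2^{<c} = c enters. It makes c regular, by Konig's diagonal argument
    ([konig], [small_bounded]), and it bounds by c the number of small
    subsets of a set of size c ([card_small_subsets]); hence c steps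
    of closing off suffice and each adds at most c points. *)

(** * Sets of cardinality at most the continuum *)

Lemma continuumE : continuum = [set: set nat].
Proof. by apply/seteqP. Qed.

Lemma card_le_inj {Z W : Type} {A : set Z} {B : set W} (f : Z -> W) :
  (forall z, A z -> B (f z)) ->
  (forall y z, A y -> A z -> f y = f z -> y = z) -> A #<= B.
Proof.
move=> fAB finj; have /injfunPex[g] : exists2 g : Z -> W, set_fun A B g & set_inj A g.
  by exists f => // y z /set_mem Ay /set_mem Az; exact: finj.
exact: inj_card_le.
Qed.

Lemma card_le_continuumP {Z : Type} {A : set Z} :
  A #<= continuum <->
  exists f : Z -> set nat, forall y z, A y -> A z -> f y = f z -> y = z.
Proof.
split=> [|[f finj]]; last first.
  by apply: (card_le_inj f) => // z _; rewrite continuumE.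
rewrite continuumE => /pcard_leTP[f]; exists f => y z Ay Az.
by apply: inj; exact/mem_set.
Qed.

Lemma continuum_leP {Z : Type} {A : set Z} :
  continuum #<= A <->
  exists g : set nat -> Z, injective g /\ forall t, A (g t).
Proof.
split=> [|[g [ginj gA]]]; last first.
  by apply: (card_le_inj g) => // y z _ _; exact: ginj.
rewrite continuumE => /card_leP[f].
pose u (t : set nat) : [set: set nat] := SigSub (mem_set (I : setT t)).
exists (fun t => val (f (u t))); split=> [y z /val_inj/inj|t]; last exact: set_valP.
by rewrite !inE => /(_ I I)/(congr1 val).
Qed.

(** A sequence of sets of naturals is the set of pairs (i, k) with k in the
    i-th term, and pairs of naturals are naturals. *)
Lemma card_seq_continuum : [set: nat -> set nat] #<= continuum.
Proof.
apply/card_le_continuumP.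
exists (fun f => [set n | exists i k, n = pickle (i, k) /\ f i k]) => f g _ _ fg.
have sub f' g' : [set n | exists i k : nat, n = pickle (i, k) /\ f' i k] =
    [set n | exists i k : nat, n = pickle (i, k) /\ g' i k] ->
    forall i k, f' i k -> g' i k.
  move=> e i k fik.
  have : [set n | exists i k : nat, n = pickle (i, k) /\ f' i k] (pickle (i, k)).
    by exists i, k.
  by rewrite e => -[i' [k' [/(pcan_inj pickleK)[-> ->]]]].
apply/funext => i; apply/seteqP; split=> k; first exact: (sub _ _ fg).
exact: (sub _ _ (esym fg)).
Qed.

Lemma pairing_continuum : exists p : set nat -> set nat -> set nat,
  forall a b a' b', p a b = p a' b' -> a = a' /\ b = b'.
Proof.
have [code codeI] := card_le_continuumP.1 card_seq_continuum.
exists (fun a b => code (fun n => if n is 0 then a else b)) => a b a' b' e.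
have {}e := codeI _ _ I I e.
by split; [exact: (congr1 (@^~ 0) e)|exact: (congr1 (@^~ 1) e)].
Qed.

Lemma card_bigcup_continuum {J Z : Type} (K : set J) (A : J -> set Z) :
  K #<= continuum -> (forall i, K i -> A i #<= continuum) ->
  \bigcup_(i in K) A i #<= continuum.
Proof.
move=> /card_le_continuumP[k kI] Ac; have [p pI] := pairing_continuum.
have /choice[f fI] i : exists f : Z -> set nat, K i ->
    forall y z, A i y -> A i z -> f y = f z -> y = z.
  have [/Ac/card_le_continuumP[f fI]|nKi] := pselect (K i); first by exists f.
  by exists (fun=> set0) => /nKi.
have /choice[s sP] z : exists t : set nat, (\bigcup_(i in K) A i) z ->
    exists i, [/\ K i, A i z & t = p (k i) (f i z)].
  have [[i Ki Aiz]|nz] := pselect ((\bigcup_(i in K) A i) z).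
    by exists (p (k i) (f i z)) => _; exists i.
  by exists set0 => /nz.
apply/card_le_continuumP; exists s => y z /sP[i [Ki Aiy ->]] /sP[j [Kj Ajz ->]].
move=> /pI[/(kI _ _ Ki Kj) ij]; subst j; exact: fI.
Qed.

Lemma card_set1_continuum {Z : Type} (z : Z) : [set z] #<= continuum.
Proof. by apply/card_le_continuumP; exists (fun=> set0) => x y -> ->. Qed.

Lemma card_setU_continuum {Z : Type} {A B : set Z} :
  A #<= continuum -> B #<= continuum -> A `|` B #<= continuum.
Proof.
move=> Ac Bc; have -> : A `|` B = \bigcup_(n : nat) (if n is 0 then A else B).
  apply/seteqP; split=> [z [Az|Bz]|z [[|n] _]]; [by exists 0|by exists 1| |].
    by left.
  by right.
apply: card_bigcup_continuum => [|[|n]//].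
apply/card_le_continuumP; exists set1 => m n _ _ mn.
by have : [set n] m by rewrite -mn.
Qed.

Lemma card_setXT_continuum {Z : Type} {A : set Z} :
  A #<= continuum -> A `*` [set: set nat] #<= continuum.
Proof.
move=> Ac; have -> : A `*` setT = \bigcup_(i : set nat) [set (z, i) | z in A].
  by apply/seteqP; split=> [[z i] [Az _]|_ [i _ [z Az <-]]]; [exists i => //; exists z|].
apply: card_bigcup_continuum => [|i _]; first by rewrite continuumE.
exact: card_le_trans (card_image_le _ _) Ac.
Qed.

(** * Regularity of the continuum *)

(** Konig's diagonal argument. Suppose that no Q i has c elements and let g
    embed the functions from J to sets of naturals into the union. The
    i-th values of the functions sent into Q i cannot exhaust all sets of
    naturals, so some x i is missed; the function x is then sent into no Q i. *)
Lemma konig {J Z : Type} (Q : J -> set Z) :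
  [set: J -> set nat] #<= continuum -> continuum #<= \bigcup_i Q i ->
  exists i, continuum #<= Q i.
Proof.
move=> /card_le_continuumP[code codeI] /continuum_leP[g [gI gQ]].
apply: contrapT => nQ.
have /choice[x xP] i : exists x, forall f, Q i (g (code f)) -> f i <> x.
  apply: contrapT => nx; apply: nQ; exists i.
  (* If every value were attained, picking a preimage of each would embed the
     continuum in Q i. *)
  have /choice[h hP] x : exists f, Q i (g (code f)) /\ f i = x.
    apply: contrapT => nf; apply: nx; exists x => f Qf fx.
    by apply: nf; exists f.
  apply/continuum_leP; exists (fun x => g (code (h x))); split=> [y z|x].
    by move=> /gI/(codeI _ _ I I) e; rewrite -(hP y).2 -(hP z).2 e.
  by have [] := hP x.
have [i _ Qi] := gQ (code x).
exact: xP Qi erefl.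
Qed.

(** * Well-orders and recursion along them *)

(** Zermelo's theorem, in the form used by the recursions below: a strict
    well-founded relation that compares any two points. *)
Lemma wf_total_order (T : Type) : exists r : T -> T -> Prop,
  well_founded r /\ forall x y, [\/ r x y, x = y | r y x].
Proof.
have [R Rwo] := @wochoice.well_ordering_principle {classic T}.
have Rch : wochoice.wo_chain R predT by move=> A _; exact: Rwo.
exists (fun x y => R x y /\ x <> y); split=> [x|x y]; last first.
  have [->|/eqP xy] := eqVneq (x : {classic T}) y; first exact: Or32.
  have /orP[Rxy|Ryx] := wochoice.wo_chainW Rch (isT : x \in predT) (isT : y \in predT).
    exact: Or31.
  by apply: Or33; split=> // /esym.
apply: contrapT => nx.
have [|z [[/asboolP nz zmin] _]] :=
    Rwo (fun x => `[< ~ Acc (fun x y => R x y /\ x <> y) x >]).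
  by exists x; apply/asboolP.
apply: nz; constructor=> y [Ryz yz]; apply: contrapT => ny; apply: yz.
apply: (wochoice.wo_chain_antisymmetric Rch) => //.
by rewrite Ryz; apply: zmin; apply/asboolP.
Qed.

(** If some proper initial segment of a well-order is as large as T, the
    least such segment carries a copy of T whose own segments are not; the
    order is pulled back along the embedding. *)
Lemma initial_well_order (T : Type) : exists r : T -> T -> Prop,
  [/\ well_founded r, forall x y, [\/ r x y, x = y | r y x] &
      forall x, ~ ([set: T] #<= [set y | r y x])].
Proof.
have [r [rwf rtot]] := wf_total_order T.
have [[x0 Tx0]|nx] := pselect (exists x, [set: T] #<= [set y | r y x]); last first.
  by exists r; split=> // x Tx; apply: nx; exists x.
have [x [Tx xmin]] : exists x, [set: T] #<= [set y | r y x] /\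
    forall y, r y x -> ~ ([set: T] #<= [set z | r z y]).
  elim/(well_founded_induction rwf): x0 Tx0 => x IH Tx.
  have [[y [ryx Ty]]|ny] := pselect (exists y, r y x /\ [set: T] #<= [set z | r z y]).
    exact: (IH y).
  by exists x; split=> // y ryx Ty; apply: ny; exists y.
have [f [fI fx]] : exists f : T -> T, injective f /\ forall t, r (f t) x.
  have /card_leP[f] := Tx.
  pose u (t : T) : [set: T] := SigSub (mem_set (I : setT t)).
  exists (fun t => val (f (u t))); split=> [y z /val_inj/inj|t].
    by rewrite !inE => /(_ I I)/(congr1 val).
  exact: (set_valP (f (u t))).
exists (fun s t => r (f s) (f t)); split=> [|s t|t].
- exact: (Inverse_Image.wf_inverse_image _ _ r f rwf).
- have [] := rtot (f s) (f t); [exact: Or31| |exact: Or33].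
  by move=> /fI; exact: Or32.
- move=> Tt; apply: (xmin (f t) (fx t)); apply: card_le_trans Tt _.
  by apply: (card_le_inj f) => // y z _ _; exact: fI.
Qed.

(** Transfinite recursion in which each stage depends only on the union of the
    earlier ones. Both the closing-off argument and the construction of the
    discrete set in Sapirovskii's lemma have this shape. *)
Lemma wf_rec_bigcup {T Z : Type} (r : T -> T -> Prop) (G : T -> set Z -> set Z) :
  well_founded r ->
  exists A : T -> set Z, forall a, A a = G a (\bigcup_(b in r^~ a) A b).
Proof.
move=> rwf.
pose F a (rec : forall b, r b a -> set Z) :=
  G a [set z | exists b (rba : r b a), rec b rba z].
exists (Fix rwf _ F) => a; rewrite Fix_eq => [|{}a f g fg].
  congr (G a _); apply/seteqP; split=> z; first by move=> [b [rba Az]]; exists b.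
  by move=> [b rba Az]; exists b, rba.
congr (G a _); apply/seteqP; split=> z [b [rba]].
  by rewrite fg => Az; exists b, rba.
by rewrite -fg => Az; exists b, rba.
Qed.

(** * Consequences of the hypothesis on the weak power of the continuum *)

Lemma small_card_exp2 (L : set (set nat)) :
  exp2_lt_continuum #= continuum ->
  ~ (continuum #<= L) -> card_exp2 L #<= continuum.
Proof.
move=> h2c Lsmall; rewrite -(card_le_eqr h2c).
apply: (card_supP _).1; exists L => //; split=> //.
by rewrite continuumE card_leT.
Qed.

(** A function from L to sets of naturals is a subset of L times the naturals.
    This product embeds in the continuum as L', the union of countably many
    copies of L, and L' is small because c does not have countable cofinality
    ([konig]). *)
Lemma small_fun_continuum (L : set (set nat)) :
  exp2_lt_continuum #= continuum -> ~ (continuum #<= L) ->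
  [set: L -> set nat] #<= continuum.
Proof.
move=> h2c Lsmall; have [p pI] := pairing_continuum.
pose L' := \bigcup_(n : nat) [set p l [set n] | l in L].
have L'small : ~ (continuum #<= L').
  move=> /(konig _ card_seq_continuum)[n cn]; apply: Lsmall.
  exact: card_le_trans cn (card_image_le _ _).
apply: card_le_trans (small_card_exp2 _ h2c L'small).
apply: (card_le_inj (fun f => [set t |
    exists l n, f l n /\ t = p (val l) [set n]])) => [f _ t|f g _ _ fg].
  by move=> [l [n [_ ->]]]; exists n => //; exists (val l) => //; exact: set_valP.
have sub f' g' : [set t | exists l n, f' l n /\ t = p (val l) [set n]] =
    [set t | exists l n, g' l n /\ t = p (val l) [set n]] ->
    forall (l : L) n, f' l n -> g' l n.
  move=> e l n fln.
  have : [set t | exists l n, f' l n /\ t = p (val l) [set n]] (p (val l) [set n]).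
    by exists l, n.
  rewrite e => -[l' [n' [gln /pI[ll' nn']]]].
  have -> : l = l' by exact: val_inj.
  by have -> : n = n' by (have : [set n'] n by rewrite -nn').
apply/funext => l; apply/seteqP; split=> n; first exact: (sub _ _ fg).
exact: (sub _ _ (esym fg)).
Qed.

Lemma small_image {Y Z : Type} (f : Y -> Z) (B : set Y) :
  ~ (continuum #<= B) -> ~ (continuum #<= f @` B).
Proof. by move=> Bsmall cB; apply: Bsmall; exact: card_le_trans cB (card_image_le _ _). Qed.

(** The regularity of c. If L were unbounded, the continuum would be the union
    over l in L of the closed segments below l. By [konig] one of them would
    have c elements, and then, by [konig] again, so would the open segment or
    the singleton that make it up. *)
Lemma small_bounded (r : set nat -> set nat -> Prop) (L : set (set nat)) :
  exp2_lt_continuum #= continuum ->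
  (forall x y, [\/ r x y, x = y | r y x]) ->
  (forall x, ~ (continuum #<= [set y | r y x])) ->
  ~ (continuum #<= L) -> exists b, forall l, L l -> r l b.
Proof.
move=> h2c rtot rsmall Lsmall; apply: contrapT => nb.
pose Q (l : L) (n : nat) := if n is 0 then [set val l] else [set y | r y (val l)].
have [l cl] : exists l : L, continuum #<= \bigcup_n Q l n.
  apply: konig; first exact: small_fun_continuum.
  rewrite continuumE; apply: subset_card_le => t _; apply: contrapT => nt.
  apply: nb; exists t => l Ll; apply: contrapT => nlt; apply: nt.
  exists (SigSub (mem_set Ll)) => //.
  have [//|lt|rtl] := rtot l t; first by exists 0 => //; exact: esym lt.
  by exists 1.
have [[|n] cn] := konig _ card_seq_continuum cl; last exact: rsmall cn.
have [g [gI gl]] := continuum_leP.1 cn.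
have T0 : [set: nat] = set0 by apply: gI; rewrite !gl.
by have : @set0 nat 0 by rewrite -T0.
Qed.

(** Embed P in the continuum. A small subset becomes bounded, so it is
    determined by a bound b and a subset of the small segment below b: at most
    c * c possibilities. *)
Lemma card_small_subsets {Z : Type} (P : set Z) :
  exp2_lt_continuum #= continuum -> P #<= continuum ->
  [set B : set Z | B `<=` P /\ ~ (continuum #<= B)] #<= continuum.
Proof.
move=> h2c /card_le_continuumP[f fI]; have [p pI] := pairing_continuum.
have [r [rwf rtot rsmall]] := initial_well_order (set nat).
rewrite -continuumE in rsmall.
have /choice[e eI] b := card_le_continuumP.1 (small_card_exp2 _ h2c (rsmall b)).
have /choice[s sP] (B : set Z) : exists b, ~ (continuum #<= B) ->
    f @` B `<=` [set y | r y b].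
  have [cB|/(small_image f)fBsmall] := pselect (continuum #<= B).
    by exists set0 => /(_ cB).
  by have [b bP] := small_bounded r (f @` B) h2c rtot rsmall fBsmall; exists b.
apply/card_le_continuumP; exists (fun B => p (s B) (e (s B) (f @` B))).
move=> B C [BP /sP BsB] [CP /sP CsC] /pI[sBC].
rewrite -sBC in CsC *; move=> /(eI _ _ _ BsB CsC) fBC.
have sub (B' C' : set Z) : B' `<=` P -> C' `<=` P -> f @` B' = f @` C' -> B' `<=` C'.
  move=> B'P C'P fE z B'z; have : (f @` B') (f z) by exists z.
  by rewrite fE => -[y C'y] /(fI _ _ (C'P _ C'y) (B'P _ B'z)) <-.
by apply/seteqP; split; exact: sub.
Qed.

(** Iterate along a well-order of type c, adding at stage a every F B for B a
    small subset of what was built before. Each stage adds at most c points;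
    a small subset of the union is already contained in the union of the
    stages before some b by regularity, so F B was added at stage b. *)
Lemma closing_off {Z : Type} (F : set Z -> set Z) :
  exp2_lt_continuum #= continuum ->
  (forall B, ~ (continuum #<= B) -> F B #<= continuum) ->
  exists A, A #<= continuum /\
    forall B, B `<=` A -> ~ (continuum #<= B) -> F B `<=` A.
Proof.
move=> h2c Fc.
have [r [rwf rtot rsmall]] := initial_well_order (set nat).
rewrite -continuumE in rsmall.
have [A AE] := wf_rec_bigcup r (fun _ P =>
  \bigcup_(B in [set B | B `<=` P /\ ~ (continuum #<= B)]) F B) rwf.
have Tc (K : set (set nat)) : K #<= continuum by rewrite continuumE card_leT.
have Ac a : A a #<= continuum.
  elim/(well_founded_induction rwf): a => a IH; rewrite AE.
  apply: card_bigcup_continuum => [|B [_ /Fc//]].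
  by apply: card_small_subsets => //; exact: card_bigcup_continuum.
exists (\bigcup_a A a); split=> [|B BA Bsmall].
  by apply: card_bigcup_continuum => // *; exact: Tc.
have /choice[s sP] z : exists a, B z -> A a z.
  have [/BA[a _ Aaz]|nBz] := pselect (B z); first by exists a.
  by exists set0 => /nBz.
have [b bP] := small_bounded r (s @` B) h2c rtot rsmall (small_image s B Bsmall).
move=> z FBz; exists b => //; rewrite AE; exists B => //; split=> // y By.
exists (s y); last exact: sP.
by apply: bP; exists y.
Qed.

(** * Discrete sets *)

Lemma discrete_setE {X : topologicalType} {A : set X} :
  discrete_set A <->
  forall x, A x -> exists2 V, nbhs x V & V `&` A `<=` [set x].
Proof.
rewrite discrete_setP; split=> [iA x|dA].
  by rewrite -{1}iA => -[_ [V xV VA]]; exists V => //; rewrite VA.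
apply/seteqP; split=> [|x Ax]; first exact: isolatedS.
split; first exact: mem_set.
have [V xV VA] := dA x Ax; exists V => //; apply/seteqP; split=> // _ ->.
by split=> //; exact: nbhs_singleton.
Qed.

Lemma sub_discrete_set {X : topologicalType} (A B : set X) :
  A `<=` B -> discrete_set B -> discrete_set A.
Proof.
move=> AB /discrete_setE dB; apply/discrete_setE => x /AB /dB[V xV VB].
by exists V => // y [Vy /AB By]; exact: VB.
Qed.

(** Go through the space along a well-order, putting a point x of Y into D
    unless it is already covered by the closure of the earlier part of D or by
    U y for an earlier y in D. Every point of Y is then covered, and D is
    discrete: U x excludes the later points of D, and the complement of the
    closure of the earlier part excludes the earlier ones. *)
Lemma sapirovskii {X : topologicalType} (Y : set X) (U : X -> set X) :
  (forall y, Y y -> open (U y) /\ U y y) ->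
  exists D, [/\ D `<=` Y, discrete_set D &
    Y `<=` closure D `|` \bigcup_(y in D) U y].
Proof.
move=> UP; have [r [rwf rtot]] := wf_total_order X.
have [A AE] := wf_rec_bigcup r (fun x P =>
  [set z | [/\ z = x, Y x, ~ closure P x & ~ (\bigcup_(y in P) U y) x]]) rwf.
(* Stage x of the recursion is {x} if x is accepted and empty otherwise. *)
pose D := \bigcup_x A x.
have DE x : D x -> A x x by move=> [y _] /[dup]; rewrite {1}AE => -[-> _ _ _].
exists D; split.
- by move=> x /DE; rewrite AE => -[].
- apply/discrete_setE => x /DE; rewrite AE => -[_ Yx xncl xnU].
  have [oUx Uxx] := UP x Yx.
  exists (U x `&` ~` closure (\bigcup_(y in r^~ x) A y)).
    apply: open_nbhs_nbhs; split; last by split.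
    by apply: openI => //; apply: closed_openC; exact: closed_closure.
  move=> y [[Uxy yncl] /DE Ay]; have [ryx|//|rxy] := rtot y x.
    by case: yncl; apply: subset_closure; exists y.
  move: Ay; rewrite AE => -[_ _ _ []]; exists x => //.
  by exists x => //; rewrite AE; split.
- move=> y Yy; have sub : \bigcup_(x in r^~ y) A x `<=` D by move=> z [x _ Axz]; exists x.
  have [|ncl] := pselect (closure (\bigcup_(x in r^~ y) A x) y).
    by left; exact: closure_subset sub _ _.
  have [[x /sub Dx Uxy]|nU] := pselect ((\bigcup_(x in \bigcup_(x in r^~ y) A x) U x) y).
    by right; exists x.
  by left; apply: subset_closure; exists y => //; rewrite AE; split.
Qed.

(** Every point x is the intersection of at most c open sets. For y other than
    x, let V y be an open neighbourhood of y whose closure avoids x. By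
    [sapirovskii] there is a discrete D such that every p other than x lies in
    the closure of D or in V y for some y in D. Hence the complements of the
    closures of the V y, for y in the closure of D and y <> x, separate x from each such
    p: in the first case take y = p. *)
Lemma pseudocharacter_le_continuum {X : topologicalType} :
  hausdorff_space X ->
  (forall D : set X, discrete_set D -> closure D #<= continuum) ->
  exists U : X -> set nat -> set X,
    (forall x i, open (U x i) /\ U x i x) /\
    (forall x p, x <> p -> exists i, ~ U x i p).
Proof.
move=> hX clc.
suff /choice[U UP] (x : X) : exists U : set nat -> set X,
    (forall i, open (U i) /\ U i x) /\ (forall p, x <> p -> exists i, ~ U i p).
  by exists U; split=> x; have [] := UP x.
have /choice[V VP] (y : X) : exists V, y <> x -> [/\ open V, V y & ~ closure V x].
  have [->|yx] := pselect (y = x); first by exists set0.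
  rewrite open_hausdorff in hX.
  have /eqP/hX[[V W] /= [/set_mem Vy /set_mem Wx] [oV oW VW]] := yx.
  exists V => _; split=> //.
  move=> /(_ W)[|z]; first exact: open_nbhs_nbhs.
  by move/eqP: VW => ->.
have [D [DY /clc Dc cov]] := sapirovskii [set~ x] V (fun y yx =>
  let: And3 oV Vy _ := VP y yx in conj oV Vy).
have [f fI] := card_le_continuumP.1 Dc.
(* The family is reindexed by all sets of naturals through an injection f of
   the closure of D; the indices that come from no such y give the whole space. *)
pose U i := [set z | forall y, closure D y -> y <> x -> f y = i -> ~ closure (V y) z].
have UE y : closure D y -> y <> x -> U (f y) = ~` closure (V y).
  move=> Dy yx; apply/seteqP; split=> z; first by move=> Uz; exact: (Uz y).
  by move=> nVz y' Dy' _ /(fI _ _ Dy' Dy) ->.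
have U1 p : x <> p -> exists2 y, closure D y /\ y <> x & V y p.
  move=> xp; have px : p <> x by move/esym.
  have [Dp|[y Dy Vyp]] := cov p px; first by exists p => //; have [] := VP p px.
  by exists y => //; split; [exact: subset_closure|exact: DY].
exists U; split=> [i|p /U1[y [Dy yx] Vyp]]; last first.
  by exists (f y); rewrite UE //; apply; exact: subset_closure.
split; last by move=> y _ yx _; have [] := VP y yx.
have [[y [Dy yx <-]]|ny] := pselect (exists y, [/\ closure D y, y <> x & f y = i]).
  by rewrite UE //; apply: closed_openC; exact: closed_closure.
suff -> : U i = setT by exact: openT.
by apply/seteqP; split=> // z _ y Dy yx fyi; case: ny; exists y.
Qed.

Lemma discrete_set0 (X : topologicalType) : discrete_set (@set0 X).
Proof. by apply/discrete_setE. Qed.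

(** A discrete set with c elements would contain a subset of cardinality
    exactly [shat X], which is again discrete. *)
Lemma small_discrete_set {X : topologicalType} (D : set X) :
  shat X #<= continuum -> discrete_set D -> ~ (continuum #<= D).
Proof.
move=> sc dD cD; have /card_leP[f] := card_le_trans sc cD.
pose h (K : shat X) : X := val (f K).
have hI : injective h by move=> K L /val_inj/inj; rewrite !inE => /(_ I I).
have hD : range h `<=` D by move=> _ [K _ <-]; exact: set_valP.
apply: ((shatP X).1 (range h)); last exact: sub_discrete_set hD dD.
apply: card_eq_trans (card_setT _).
by apply: inj_card_eq => K L _ _; exact: hI.
Qed.

(** * The cardinality bound *)

Theorem theorem3p6 (h2c : exp2_lt_continuum #= continuum)
  (X : topologicalType) (hX : hausdorff_space X)
  (hsg : shat X `*` gsup X #<= continuum) :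
  [set: X] #<= continuum.
Proof.
have [[x0 _]|] := pselect ([set: X] !=set0); last first.
  by move=> /nonemptyPn ->; exact: card_ge0.
have cl_g (D : set X) : discrete_set D -> closure D #<= gsup X.
  by move=> dD; apply: (card_supP _).1; exists D.
(* Both factors of the product are nonempty, so each embeds in it. *)
have [K0 sK0] : shat X !=set0.
  apply: contrapT => /nonemptyPn s0.
  apply: ((shatP X).1 set0); last exact: discrete_set0.
  by rewrite s0 card_eq00.
have [y0 gy0] : gsup X !=set0.
  apply: contrapT => /nonemptyPn g0.
  have /cl_g : discrete_set [set x0].
    by apply/discrete_setE => x ->; exists setT; [exact: filterT|move=> y []].
  rewrite g0 => /card_le0P c0.
  by have : closure [set x0] x0 by [exact: subset_closure]; rewrite c0.
have sc : shat X #<= continuum.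
  apply: card_le_trans hsg; apply: (card_le_inj (fun K => (K, y0))) => //.
  by move=> K L _ _ [].
have clc (D : set X) : discrete_set D -> closure D #<= continuum.
  move=> /cl_g cD; apply: card_le_trans cD _; apply: card_le_trans hsg.
  by apply: (card_le_inj (fun x => (K0, x))) => // x y _ _ [].
have [U [UP Usep]] := pseudocharacter_le_continuum hX clc.
pose W (B : set (X * set nat)) :=
  closure (fst @` B) `|` \bigcup_(b in B) U b.1 b.2.
(* q B witnesses that W B does not cover the space, whenever this is so. *)
have /choice[q qP] B : exists x, W B = setT \/ ~ W B x.
  have [[x nWx]|nW] := pselect (exists x, ~ W B x); first by exists x; right.
  exists x0; left; apply/seteqP; split=> // x _; apply: contrapT => nWx.
  by apply: nW; exists x.
(* The closing-off takes place in the product of X with the set of indices, so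
   that a small set B records both points and the indices chosen at them. Each
   new point enters with all its indices. *)
have [|A [Ac Acl]] := closing_off (fun B =>
    [set b | discrete_set (fst @` B) /\ (closure (fst @` B) `|` [set q B]) b.1]) h2c.
  move=> B _; have [dB|ndB] := pselect (discrete_set (fst @` B)).
    apply: card_le_trans (card_setXT_continuum
      (card_setU_continuum (clc _ dB) (card_set1_continuum (q B)))).
    by apply: subset_card_le => -[x i] [_ clx]; split.
  by apply: (card_le_inj (fun=> set0)) => [b [/ndB]|b c [/ndB]].
suff AT : forall p, A (p, set0).
  apply: card_le_trans Ac; apply: (card_le_inj (fun x => (x, set0))) => //.
  by move=> x y _ _ [].
pose A' := [set x | forall i, A (x, i)].
suff A'T p : A' p by move=> p; exact: A'T.
apply: contrapT => nA'p.
have /choice[i iP] x : exists i, A' x -> ~ U x i p.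
  have [/Usep[i nU]|/contrapT->] := pselect (x <> p); first by exists i.
  by exists set0 => /nA'p.
have [D [DA' dD cov]] := sapirovskii A' (fun x => U x (i x)) (fun x _ => UP x (i x)).
pose B := (fun x => (x, i x)) @` D.
have fB : fst @` B = D by rewrite image_comp image_id.
have Bsmall : ~ (continuum #<= B) by apply: small_image; exact: small_discrete_set.
have BA : B `<=` A by move=> _ [x /DA' A'x <-].
have FA x : (closure D `|` [set q B]) x -> A' x.
  by move=> Dx j; apply: (Acl B BA Bsmall); rewrite /= fB.
have [WT|] := qP B.
  have : W B p by rewrite WT.
  rewrite /W fB => -[Dp|[_ [x Dx <-]] /=]; first by apply/nA'p/FA; left.
  exact: iP (DA' _ Dx).
rewrite /W fB; apply.
have [Dq|[x Dx Uq]] := cov _ (FA _ (or_intror erefl)); first by left.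
by right; exists (x, i x) => //; exists x.
Qed.
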